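(* Let $k\ge 3$ and $n\ge 1$ be integers and let $[a_0,\dots,a_{k-1}]$ represent a $k$-gon modulo $n$. Let $G=G(a_0,\dots,a_{k-1})=\langle\sigma_0,\sigma_1\rangle$ be its monodromy group. Set $N=\langle \sigma_0^x\sigma_1^x : 0<x<k\rangle$ and $H=\langle\sigma_0\rangle$. Then $G=N\rtimes H$, i.e. $N$ is a normal subgroup of $G$, $N\cap H=\{\mathrm{id}\}$ and $NH=G$.
   Context: A $k$-tuple of positive integers $[a_0,\dots,a_{k-1}]$ ($k\ge 3$) represents a (geometric) $k$-gon modulo $n$ if $a_0+\dots+a_{k-1}=(k-2)n$, $a_i<2n$ and $a_i\ne n$ for all $i$, and $\gcd(a_0,\dots,a_{k-1},n)=1$; it encodes a polygon with consecutive angles $a_i\pi/n$. Indices of the $a_i$ are read modulo $k$. The dessin d'enfant drawn on the rational billiards surface of this polygon has edge set identified with the set $\mathbb{Z}/n\mathbb{Z}\times\mathbb{Z}/k\mathbb{Z}$ (pairs $(m,i)$), and its monodromy group $G(a_0,\dots,a_{k-1})$ is the group of permutations of $\mathbb{Z}/n\mathbb{Z}\times\mathbb{Z}/k\mathbb{Z}$ generated by $\sigma_0(m,i)=(m,i+1)$ and $\sigma_1(m,i)=(m-a_{i-1},\,i-1)$. *)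

(* Defs.v *)
From mathcomp Require Import all_boot all_order all_algebra all_fingroup.

Set Implicit Arguments.
Unset Strict Implicit.
Unset Printing Implicit Defensive.

Import GRing.Theory.

(* Z/nZ for every n >= 1; 'Z_n has two elements when n = 1. *)
Notation Zmod n := 'I_(n.-1.+1).

Definition represents_polygon (n k : nat) (a : k.-tuple nat) : Prop :=
  [/\ forall i, 0 < tnth a i,
      \sum_i tnth a i = (k - 2) * n,
      forall i, tnth a i < 2 * n,
      forall i, tnth a i != n
    & gcdn (\big[gcdn/0]_i tnth a i) n = 1].

(* In Zmod k, inZp 1 is the class of 1; j : Zmod k stands for its representative
   in {0, ..., k-1}, so that nth 0 a j is a_j with its index read modulo k. *)
Definition sigma0_fun (n k : nat) (e : Zmod n * Zmod k) : Zmod n * Zmod k :=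
  (e.1, (e.2 + inZp 1)%R).

Definition sigma1_fun (n k : nat) (a : k.-tuple nat) (e : Zmod n * Zmod k) :
    Zmod n * Zmod k :=
  let j := (e.2 - inZp 1)%R in ((e.1 - inZp (nth 0 a j))%R, j).

Lemma sigma0_inj (n k : nat) : injective (@sigma0_fun n k).
Proof. by move=> [m i] [m' i'] /pair_equal_spec [/= -> /addIr ->]. Qed.

Lemma sigma1_inj (n k : nat) (a : k.-tuple nat) : injective (@sigma1_fun n k a).
Proof.
by move=> [m i] [m' i'] /pair_equal_spec [/= + /addIr ei]; rewrite ei => /addIr ->.
Qed.

Definition sigma0 (n k : nat) : {perm Zmod n * Zmod k} := perm (@sigma0_inj n k).

Definition sigma1 (n k : nat) (a : k.-tuple nat) : {perm Zmod n * Zmod k} :=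
  perm (@sigma1_inj n k a).

Definition monodromy (n k : nat) (a : k.-tuple nat) :
    {group {perm Zmod n * Zmod k}} :=
  <<[set sigma0 n k; sigma1 n a]>>%G.

(* The product s * t of permutations applies s first. The opposite convention
   gives the same N: when a represents a k-gon modulo n, sigma1 ^+ x * sigma0 ^+ x
   is the inverse of sigma0 ^+ (k - x) * sigma1 ^+ (k - x). *)
Definition monodromyN (n k : nat) (a : k.-tuple nat) :
    {group {perm Zmod n * Zmod k}} :=
  <<[set (sigma0 n k ^+ x * sigma1 n a ^+ x)%g | x : 'I_k & (0 < x)%N]>>%G.

Definition monodromyH (n k : nat) : {group {perm Zmod n * Zmod k}} :=
  <[sigma0 n k]>%G.

(* Main.v *)
(* Write s, t for sigma0, sigma1. Each s^x t^x fixes the second coordinate,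
   whereas s shifts it, so N and H meet trivially. The rest is formal from
   s^k = t^k = 1, where t^k = 1 because a_0 + ... + a_(k-1) vanishes modulo n:
   conjugating s^x t^x by s gives (s^(x-1) t^(x-1)) (s^(k-1) t^(k-1))^-1, so H
   normalises N, and t = s^-1 (s t) lies in the group generated by N and H. *)

Require Import Defs.
From mathcomp Require Import all_boot all_order all_algebra all_fingroup.

Local Open Scope group_scope.

Section PowerProducts.

Variables (gT : finGroupType) (k : nat) (s t : gT).
Hypotheses (k_gt1 : (1 < k)%N) (sk1 : s ^+ k = 1) (tk1 : t ^+ k = 1).

Let N := <<[set s ^+ x * t ^+ x | x : 'I_k & (0 < x)%N]>>.

(** Index 0 is not among the generators, but its product is 1. Admitting it covers the conjugate by
    [s] of the generator of index 1, which involves [s ^+ 0 * t ^+ 0]. *)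
Lemma mem_power_products x : (x < k)%N -> s ^+ x * t ^+ x \in N.
Proof.
case: x => [|x] ltxk; first by rewrite !expg0 mulg1 group1.
by apply/mem_gen/imsetP; exists (Ordinal ltxk); rewrite ?inE.
Qed.

Lemma power_products_norm : <[s]> \subset 'N(N).
Proof.
(* Since [s ^+ k.-1] and [t ^+ k.-1] are the inverses of [s] and [t], this places [t * s] in [N]. *)
have ts : (s ^+ k.-1 * t ^+ k.-1)^-1 = t * s.
  have pred_inv (u : gT) : u ^+ k = 1 -> u ^+ k.-1 = u^-1.
    by move=> uk1; apply/eqP; rewrite eq_sym eq_invg_mul -expgS prednK ?uk1 // ltnW.
  by rewrite !pred_inv // invMg !invgK.
(* Normalising means [N :^ s \subset N], so it is enough to conjugate the generators of [N]. *)
rewrite cycle_subG inE -genJ gen_subG.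
apply/subsetP=> _ /imsetP[_ /imsetP[[x ltxk] /[!inE]/= x_gt0 ->] ->].
case: x x_gt0 ltxk => // x _ ltxk.
have -> : (s ^+ x.+1 * t ^+ x.+1) ^ s = s ^+ x * t ^+ x * (t * s).
  by rewrite conjgE [s ^+ x.+1]expgS [t ^+ x.+1]expgSr !mulgA mulVg mul1g.
by rewrite -ts groupM ?groupV ?mem_power_products // ?(ltnW ltxk) ?ltn_predL // ltnW.
Qed.

Lemma power_products_mul_cycle : N * <[s]> = <<[set s; t]>>.
Proof.
have sN : s \in N <*> <[s]> by rewrite (subsetP (joing_subr _ _)) ?cycle_id.
rewrite -norm_joinEr ?power_products_norm //; apply/eqP; rewrite eqEsubset.
rewrite join_subG cycle_subG !gen_subG mem_gen ?set21 // andbT.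
apply/andP; split; apply/subsetP=> u.
  by case/imsetP=> x _ ->; rewrite groupM ?groupX ?mem_gen ?set21 ?set22.
case/set2P=> -> //; rewrite -(groupMl t sN).
by rewrite (subsetP (joing_subl _ _)) // (mem_power_products 1).
Qed.

End PowerProducts.

(** With a group structure on this set, containment of [monodromyN] in it can be tested on
    generators. *)
Lemma snd_fixing_group_set (T1 T2 : finType) :
  group_set [set p : {perm T1 * T2} | [forall e, (p e).2 == e.2]].
Proof.
apply/group_setP; split=> [|p q].
  by rewrite inE; apply/forallP=> e; rewrite perm1.
rewrite !inE => /forallP fixp /forallP fixq; apply/forallP=> e.
by rewrite permM (eqP (fixq _)).
Qed.

Lemma inZpD n x y : (inZp x + inZp y = inZp (x + y) :> Zmod n)%R.
Proof. by apply: val_inj; rewrite /= modnDm. Qed.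

Lemma sigma0X n k x e : (sigma0 n k ^+ x) e = (e.1, (e.2 + inZp 1 *+ x)%R).
Proof.
elim: x => [|x IHx]; first by rewrite expg0 perm1 GRing.addr0 -surjective_pairing.
by rewrite expgSr permM IHx permE /sigma0_fun /= -GRing.addrA -GRing.mulrSr.
Qed.

(** Each step subtracts the entry just below the current index, so from index i the entries met are
    those at i-1, i-2, ..., i-x; hence the [j.+1]. *)
Lemma sigma1X n k (a : k.-tuple nat) x e :
  (sigma1 n a ^+ x) e =
    ((e.1 - inZp (\sum_(j < x) nth 0 a (e.2 - inZp 1 *+ j.+1)%R))%R,
     (e.2 - inZp 1 *+ x)%R).
Proof.
elim: x => [|x IHx].
  rewrite expg0 perm1 big_ord0 GRing.subr0 [RHS]surjective_pairing /=.
  rewrite (_ : inZp 0 = 0%R) ?GRing.subr0 -?surjective_pairing //.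
  by apply: val_inj; rewrite /= mod0n.
rewrite expgSr permM IHx permE /sigma1_fun big_ord_recr [(_, _).1]/= [(_, _).2]/=.
rewrite -(GRing.addrA e.2) -GRing.opprD -GRing.mulrSr.
by rewrite -(GRing.addrA e.1) -GRing.opprD inZpD.
Qed.

Lemma Zmod_mulrn k x : (inZp 1 *+ x = inZp x :> Zmod k)%R.
Proof.
elim: x => [|x IHx]; first by apply: val_inj; rewrite /= mod0n.
by rewrite GRing.mulrSr IHx inZpD addn1.
Qed.

Lemma Zmod_mulrn_card k : 0 < k -> (inZp 1 *+ k = 0 :> Zmod k)%R.
Proof. by case: k => // k _; rewrite Zmod_mulrn; apply/val_inj/modnn. Qed.

Lemma sigma0_expk n k : 0 < k -> sigma0 n k ^+ k = 1.
Proof.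
move=> k_gt0; apply/permP=> e.
by rewrite sigma0X Zmod_mulrn_card // GRing.addr0 perm1 -surjective_pairing.
Qed.

Lemma sigma1_expk n k (a : k.-tuple nat) :
  0 < n -> 0 < k -> n %| \sum_i tnth a i -> sigma1 n a ^+ k = 1.
Proof.
move=> n_gt0 k_gt0 dvd_sum; apply/permP=> e.
rewrite sigma1X Zmod_mulrn_card // GRing.subr0 perm1.
(* In [k] steps the index makes a full turn and meets every entry exactly once. *)
suff -> : \sum_(j < k) nth 0 a (e.2 - inZp 1 *+ j.+1)%R = \sum_i tnth a i.
  have -> : inZp (\sum_i tnth a i) = 0%R :> Zmod n.
    by apply: val_inj; rewrite /= prednK //; apply/eqP.
  by rewrite GRing.subr0 -surjective_pairing.
(* For a successor, [Zmod k] is the index type of the tuple itself, so the sum can be reindexed by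
   the injection below. *)
case: k a k_gt0 e dvd_sum => // k a _ e _.
have rot_inj : injective (fun j : 'I_k.+1 => e.2 - inZp 1 *+ j.+1)%R.
  move=> i j /GRing.addrI/GRing.oppr_inj; rewrite !GRing.mulrSr => /GRing.addIr.
  by rewrite !Zmod_mulrn !valZpK.
rewrite [RHS](reindex_inj rot_inj) /=.
by apply: eq_bigr => j _; rewrite (tnth_nth 0).
Qed.

Lemma monodromyN_snd n k (a : k.-tuple nat) p e :
  p \in monodromyN n a -> (p e).2 = e.2.
Proof.
pose S := Group (snd_fixing_group_set (Zmod n) (Zmod k)).
suff /subsetP sNS : monodromyN n a \subset S.
  by move/sNS; rewrite inE => /forallP/(_ e)/eqP.
rewrite gen_subG; apply/subsetP=> _ /imsetP[x _ ->]; rewrite inE.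
by apply/forallP=> d; rewrite permM sigma1X sigma0X /= GRing.addrK.
Qed.

(** A power of [sigma0] always keeps the first coordinate; if it lies in [monodromyN] it keeps the
    second one too. *)
Lemma monodromyN_H_TI n k (a : k.-tuple nat) :
  monodromyN n a :&: monodromyH n k = 1.
Proof.
apply/trivgP/subsetP=> p /setIP[Np /cycleP[x def_p]]; rewrite inE def_p.
apply/eqP/permP=> e; have := monodromyN_snd _ _ _ _ e Np.
by rewrite def_p perm1 sigma0X /= => ->; rewrite -surjective_pairing.
Qed.

Theorem theorem1 (n k : nat) (a : k.-tuple nat) (hk : (3 <= k)%N) (hn : (1 <= n)%N)
    (ha : represents_polygon n a) :
  monodromyN n a ><| monodromyH n k = monodromy n a /\
  [/\ monodromyN n a <| monodromy n a,
      monodromyN n a :&: monodromyH n k = 1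
    & monodromyN n a * monodromyH n k = monodromy n a].
Proof.
have k_gt1 : 1 < k := ltnW hk; have k_gt0 : 0 < k := ltnW k_gt1.
have s0k := sigma0_expk n k k_gt0.
have s1k : sigma1 n a ^+ k = 1.
  (* The angle sum is [(k - 2) * n], a multiple of [n]. *)
  by apply: sigma1_expk => //; case: ha => _ -> _ _ _; apply: dvdn_mull.
have nNH := power_products_norm _ _ _ _ k_gt1 s0k s1k.
have NH := power_products_mul_cycle _ _ _ _ k_gt1 s0k s1k.
have TI := monodromyN_H_TI n k a.
have sdG : monodromyN n a ><| monodromyH n k = monodromy n a.
  by rewrite sdprodE.
by split=> //; split=> //; case/sdprod_context: sdG.
Qed.
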